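(* Let $\zeta=(\zeta_t,t\ge 0)$ be a Lévy bridge with random length $\tau$ and random pinning point $Z$ derived from the Lévy process $X$, and let $a_{ac}\in[0,1]$ be the weight of the absolutely continuous part in the Lebesgue decomposition of the law of $Z$. Then the event $\{\tau\leq t\}$ belongs to $\sigma(\zeta_t)\vee\mathcal{N}_{\mathbb{P}}$ for all $t>0$ if and only if $a_{ac}=0$.
   Context: Everything is defined on a complete probability space $(\Omega,\mathcal{F},\mathbb{P})$; $\mathcal{N}_{\mathbb{P}}$ is the collection of $\mathbb{P}$-null sets, and $\mathbb{P}_\theta$ denotes the law of a random variable $\theta$ under $\mathbb{P}$. Let $X=(X_t,t\ge0)$ be a one-dimensional Lévy process (realized as the coordinate process on the Skorohod space of càdlàg functions). Standing assumption: for every $t>0$ the law of $X_t$ is absolutely continuous with respect to Lebesgue measure, with density $f^X_t$. Deterministic bridges: for $r>0$ and $z\in\mathbb{R}$ with $0<f^X_r(z)<+\infty$, $\mathbb{P}^{r,z}$ denotes the unique probability measure such that $\mathbb{P}^{r,z}|_{\mathcal{F}^X_t}=\frac{f^X_{r-t}(z-X_t)}{f^X_r(z)}\,\mathbb{P}|_{\mathcal{F}^X_t}$ for all $t<r$, where $\mathcal{F}^X_t=\sigma(X_s,s\le t)$; it is the law of the bridge from $0$ to $z$ of length $r$ associated with $X$. $X^{r,z}=(X^{r,z}_t)_{0\le t\le r}$ denotes a càdlàg process with this law; it satisfies $\mathbb{P}(X^{r,z}_0=0,X^{r,z}_r=z)=1$, and for $0=t_0<t_1<\dots<t_n<r$ and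 $x_0=0$, $$\mathbb{P}(X^{r,z}_{t_1}\in \mathrm{d}x_1,\ldots,X^{r,z}_{t_n}\in \mathrm{d}x_n)=\frac{f^X_{r-t_n}(z-x_n)}{f^X_r(z)}\prod_{i=1}^n f^X_{t_i-t_{i-1}}(x_i-x_{i-1})\,\mathrm{d}x_1\ldots \mathrm{d}x_n.$$ The process $X^{r,z}$ is extended to $[0,\infty)$ by setting $X^{r,z}_t=z$ for $t\ge r$. Random bridges: let $\tau$ and $Z$ be two independent random variables with values in $(0,+\infty)$ and $\mathbb{R}$ respectively. A process $\zeta$ is the Lévy bridge with random length $\tau$ and pinning point $Z$ derived from $X$ if: (i) $0<f^X_r(z)<\infty$ for $\mathbb{P}_{(\tau,Z)}$-almost every $(r,z)$; (ii) the conditional distribution of $\zeta$ given $\{\tau=r,Z=z\}$ is the law of the (extended) process $X^{r,z}$. Lebesgue decomposition: the law of $Z$ is written $\mathbb{P}_Z=(1-a_{ac})\mathbb{P}^{s}_Z+a_{ac}\mathbb{P}^{ac}_Z$ with $a_{ac}\in[0,1]$, where $\mathbb{P}^{ac}_Z$ is a probability measure absolutely continuous with respect to Lebesgue measure and $\mathbb{P}^s_Z$ is a probability measure singular with respect to Lebesgue measure.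
   Formalization: The ''only if'' direction is stated for τ not almost surely constant, since for constant τ (e.g. X Brownian, τ=1, Z Gaussian) the event {τ≤t} is always trivial while a_ac=1; the ''if'' direction is stated without restriction. *)

(* Defs.v *)
From HB Require Import structures.
From mathcomp Require Import all_boot all_order all_algebra.
From mathcomp Require Import all_classical all_reals all_analysis.
From mathcomp Require Import measurable_realfun.
Set Implicit Arguments.
Unset Strict Implicit.
Unset Printing Implicit Defensive.
Import Order.TTheory GRing.Theory Num.Theory.
Import numFieldNormedType.Exports.

Local Open Scope classical_set_scope.
Local Open Scope ring_scope.

(* The càdlàg functions on [0, +oo[.  Such a function is represented by its
   extension to the whole line that is constant on ]-oo, 0], so that elements
   of this type correspond bijectively to càdlàg functions on [0, +oo[. *)
Record skorohod (R : realType) := Skorohod {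
  cadlag_path :> R -> R ;
  cadlag_right : forall t, 0 <= t ->
    cadlag_path x @[x --> t^'+] --> cadlag_path t ;
  cadlag_left : forall t, 0 < t -> cvg (cadlag_path x @[x --> t^'-]) ;
  cadlag_neg : forall t, t < 0 -> cadlag_path t = cadlag_path 0 }.

Section skorohod_measurable.
Variable R : realType.

Definition zero_path : skorohod R :=
  @Skorohod R (fun=> 0) (fun t _ => cvg_cst _) (fun t _ => is_cvg_cst _)
    (fun t _ => erefl).

HB.instance Definition _ := gen_eqMixin (skorohod R).
HB.instance Definition _ := gen_choiceMixin (skorohod R).
HB.instance Definition _ := isPointed.Build (skorohod R) zero_path.

Definition cylinders (T : set R) : set (set (skorohod R)) :=
  \bigcup_(s in T)
    preimage_set_system setT (fun w : skorohod R => w s)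
      (@measurable _ R).

(* F^X_t = sigma(X_s, 0 <= s <= t) for the coordinate process X. *)
Definition coord_filtration (t : R) : set (set (skorohod R)) :=
  <<s cylinders `[0, t] >>.

Definition skorohod_display : measure_display :=
  sigma_display (cylinders `[0, +oo[).

HB.instance Definition _ := @isMeasurable.Build skorohod_display
  (skorohod R) <<s cylinders `[0, +oo[ >>
  (@sigma_algebra0 _ setT (cylinders `[0, +oo[))
  (@sigma_algebraC _ (cylinders `[0, +oo[))
  (@sigma_algebra_bigcup _ setT (cylinders `[0, +oo[)).

End skorohod_measurable.

Section levy.
Variable R : realType.
Implicit Types (PX : probability (skorohod R) R) (f : R -> R -> \bar R).

Definition independent_increments PX :=
  forall (n : nat) (t : nat -> R) (B : nat -> set R),
    0 <= t 0%N -> (forall i, (i < n)%N -> t i <= t i.+1) ->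
    (forall i, (i < n)%N -> measurable (B i)) ->
    PX [set w | forall i, (i < n)%N -> B i (w (t i.+1) - w (t i))] =
    (\prod_(i < n) PX [set w | B i (w (t i.+1) - w (t i))%R])%E.

Definition stationary_increments PX :=
  forall (s t : R) (B : set R),
    0 <= s -> 0 <= t -> measurable B ->
    PX [set w | B (w (s + t) - w s)] = PX [set w | B (w t)].

(* PX is the law of a one-dimensional Lévy process, realized as the coordinate
   process.  Stochastic continuity is not listed: it follows from the
   càdlàg property of paths and the stationarity of increments. *)
Definition levy PX :=
  [/\ {ae PX, forall w : skorohod R, w 0 = 0}, independent_increments PX &
      stationary_increments PX].

(* f t is a density (a fixed version, with values in [0, +oo]) of the law of
   X_t under PX, for every t > 0. *)
Definition levy_density PX f :=
  forall t : R, 0 < t ->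
    [/\ measurable_fun setT (f t),
        forall x, (0 <= f t x)%E &
        forall B : set R, measurable B ->
          PX [set w | B (w t)] = (\int[lebesgue_measure]_(x in B) f t x)%E].

(* Only meaningful when 0 < f r z < +oo. *)
Definition bridge_law PX f (r z : R) (Q : set (skorohod R) -> \bar R) :=
  forall t : R, 0 <= t -> t < r ->
    forall A, coord_filtration t A ->
      Q A = (\int[PX]_(w in A) (f (r - t)%R (z - w t)%R / f r z))%E.

(* The first condition determines the law of the bridge up to time r-; the
   second one says that the process has been set to z from time r on. *)
Definition extended_bridge_law PX f (r z : R)
    (Q : {measure set (skorohod R) -> \bar R}) :=
  bridge_law PX f r z Q /\
  {ae Q, forall w : skorohod R, forall t, r <= t -> w t = z}.

End levy.

Section random_elements.
Context d (Omega : measurableType d) (R : realType) (P : probability Omega R).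

Definition independent_RV d1 d2 (T1 : measurableType d1)
    (T2 : measurableType d2) (X : {RV P >-> T1}) (Y : {RV P >-> T2}) :=
  forall (A : set T1) (B : set T2), measurable A -> measurable B ->
    P (X @^-1` A `&` Y @^-1` B) = (P (X @^-1` A) * P (Y @^-1` B))%E.

Definition pair_RV d1 d2 (T1 : measurableType d1) (T2 : measurableType d2)
  (X : {RV P >-> T1}) (Y : {RV P >-> T2}) : Omega -> T1 * T2 :=
  fun w => (X w, Y w).

HB.instance Definition _ d1 d2 (T1 : measurableType d1)
    (T2 : measurableType d2) (X : {RV P >-> T1}) (Y : {RV P >-> T2}) :=
  isMeasurableFun.Build _ _ _ _ (pair_RV X Y)
    (measurable_fun_pair (measurable_funPT X) (measurable_funPT Y)).

(* The kernel k is a regular conditional distribution of Y given V. *)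
Definition conditional_distribution d1 d2 (T1 : measurableType d1)
    (T2 : measurableType d2) (Y : {RV P >-> T1}) (V : {mfun Omega >-> T2})
    (k : R.-pker T2 ~> T1) :=
  forall (A : set T2) (B : set T1), measurable A -> measurable B ->
    P (V @^-1` A `&` Y @^-1` B) =
    (\int[distribution P V]_(v in A) k v B)%E.

Definition levy_bridge (PX : probability (skorohod R) R) (f : R -> R -> \bar R)
    (tau Z : {RV P >-> R}) (zeta : {RV P >-> skorohod R}) :=
  {ae distribution P (pair_RV tau Z), forall rz,
     (0 < f rz.1 rz.2)%E /\ (f rz.1 rz.2 < +oo)%E} /\
  exists k : R.-pker (R * R)%type ~> skorohod R,
    conditional_distribution zeta (pair_RV tau Z) k /\
    {ae distribution P (pair_RV tau Z), forall rz,
       extended_bridge_law PX f rz.1 rz.2 (k rz)}.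

(* sigma(zeta_t) \/ N_P *)
Definition completed_sigma_at (zeta : {RV P >-> skorohod R}) (t : R) :
    set (set Omega) :=
  <<s preimage_set_system setT (fun w => zeta w t)
        (@measurable _ R) `|` P.-negligible >>.

End random_elements.

Section lebesgue_decomposition.
Variable R : realType.
Implicit Types mu nu : set R -> \bar R.

Definition mutually_singular mu nu :=
  exists N, [/\ measurable N, mu (~` N) = 0%E & nu N = 0%E].

(* mu = (1 - a) mus + a muac *)
Definition lebesgue_decomposition (mu mus muac : probability R R)
    (a : R) :=
  [/\ 0 <= a <= 1,
      mutually_singular mus lebesgue_measure,
      muac `<< lebesgue_measure &
      forall A, measurable A ->
        mu A = ((1 - a)%:E * mus A + a%:E * muac A)%E].

End lebesgue_decomposition.

(* Main.v *)
From HB Require Import structures.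
Require Import Defs.
From mathcomp Require Import all_boot all_order all_algebra.
From mathcomp Require Import all_classical all_reals all_analysis.
From mathcomp Require Import measurable_realfun.
Set Implicit Arguments.
Unset Strict Implicit.
Unset Printing Implicit Defensive.
Import Order.TTheory GRing.Theory Num.Theory.
Import numFieldNormedType.Exports.
Local Open Scope classical_set_scope.
Local Open Scope ring_scope.

(* If [a_ac = 0], then [Z] lives on a Lebesgue-null set [N], whereas [zeta_t]
   has a density before [tau]; so [{tau <= t} = {zeta_t \in N}] up to null sets.

   Conversely let [0 < P(tau <= t0) < 1].  For each rational [q > t0] we have
   [{tau <= q} = {zeta_q \in B_q}] up to a null set, which says that [Z \in B_q]
   a.s. and that, for almost every [(r, z)] with [q < r], the bridge from [0] to
   [z] of length [r] a.s. avoids [B_q] at time [q].  If [a_ac <> 0], fix a good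
   [r > t0]: the good [z] form a set [A] of positive Lebesgue measure, contained
   in all the [B_q], with [P(X_r \in A) > 0], and integrating over [z] gives
   [P(X_q \in A, X_r \in A) = 0] for all rational [q] in [(t0, r)].  But [X_q]
   tends to [X_r] in probability as [q] tends to [r], and the laws of [X_q],
   [q >= t0], are uniformly absolutely continuous, so these probabilities tend
   to [P(X_r \in A)], a contradiction. *)

(** * Translation invariance of Lebesgue measure and of its integral *)

Section lebesgue_shift.
Variable R : realType.
Local Notation leb := (@lebesgue_measure R).

Lemma lebesgue_measure_shift (a : R) (A : set R) : measurable A ->
  leb [set x | A (x + a)] = leb A.
Proof.
move=> mA; apply/esym.
have mphi : measurable_fun setT
    ((fun x => x + a) : measurableTypeR R -> measurableTypeR R).
  exact: measurable_funD.
apply: (@lebesgue_measure_unique R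
  (pushforward leb ((fun x => x + a) : _ -> measurableTypeR R))) => //= _ [[b c]] _ <-.
rewrite /pushforward.
rewrite (_ : _ @^-1` _ = `]b - a, c - a]%classic); last first.
  by apply/seteqP; split => x /=; rewrite !in_itv/= ltrBlDr lerBrDr.
rewrite !lebesgue_measure_itv/= !lte_fin ltrD2r.
by case: ifP => // _; rewrite -!EFinB opprB addrA subrK.
Qed.

Lemma ge0_integral_shift (a : R) (g : R -> \bar R) :
  measurable_fun setT g -> (forall x, 0 <= g x)%E ->
  (\int[leb]_x g (x + a)%R = \int[leb]_x g x)%E.
Proof.
move=> mg g0.
have mphi : measurable_fun setT
    ((fun x => x + a) : measurableTypeR R -> measurableTypeR R).
  exact: measurable_funD.
rewrite -[LHS](@ge0_integral_pushforward _ _ _ _ R _ mphi leb setT g)//.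
by apply: eq_measure_integral => A mA _; exact: lebesgue_measure_shift.
Qed.

End lebesgue_shift.

(** * Absolute continuity in epsilon-delta form *)

Lemma dominates_continuous d (T : measurableType d) (R : realType)
    (nu : probability T R) (mu : {measure set T -> \bar R}) :
  nu `<< mu -> forall e : R, 0 < e -> exists2 del : R, 0 < del &
    forall A, measurable A -> (mu A < del%:E)%E -> (nu A < e%:E)%E.
Proof.
move=> numu e e0; pose c := charge_of_finite_measure nu.
have [P [N PN]] := Hahn_decomposition c.
have cmu : c `<< mu by [].
have [del [del0 H]] := charge_variation_continuous PN cmu e0.
exists del => // A mA muA.
apply: le_lt_trans (H _ mA muA).
apply: le_trans (abse_charge_variation PN mA).
by rewrite gee0_abs//; exact: measure_ge0.
Qed.

(* [R] and [measurableTypeR R] carry convertible sigma-algebras but different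
   displays; [nu] is moved to the latter, on which [lebesgue_measure] lives. *)
Lemma lebesgue_dominates_continuous (R : realType) (nu : probability R R) :
  nu `<< (@lebesgue_measure R) -> forall e : R, 0 < e -> exists2 del : R, 0 < del &
    forall A : set R, measurable A ->
      (lebesgue_measure A < del%:E)%E -> (nu A < e%:E)%E.
Proof.
move=> numu e e0.
have mid : measurable_fun setT (idfun : R -> measurableTypeR R).
  by move=> _ B mB; rewrite setTI.
pose X : {mfun R >-> measurableTypeR R} :=
  HB.pack (idfun : R -> measurableTypeR R) (isMeasurableFun.Build _ _ _ _ _ mid).
exact: (@dominates_continuous _ (measurableTypeR R) R (distribution nu X)
  lebesgue_measure numu e e0).
Qed.

(** * Measurability of the coordinate maps on path space *)

Section coordinates.
Variable R : realType.
Implicit Types (t : R) (B : set R).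

Definition path_at t (w : skorohod R) : R := w t.

Lemma coord_filtration_path_at t B : 0 <= t -> measurable B ->
  coord_filtration t (path_at t @^-1` B).
Proof.
move=> t0 mB; apply: sub_sigma_algebra; exists t.
  by rewrite /= in_itv/= t0 lexx.
by exists B => //; rewrite setTI.
Qed.

Lemma measurable_path_at t : measurable_fun setT (path_at t).
Proof.
(* The generating cylinders only involve nonnegative times; at a negative time a path takes its
   value at [0]. *)
suff H s : 0 <= s -> measurable_fun setT (path_at s).
  have [t0|t0] := leP 0 t; first exact: H.
  rewrite (_ : path_at t = path_at 0); first exact: H.
  by apply/funext => w; exact: cadlag_neg.
move=> s0 _ B mB; rewrite setTI.
apply: sub_sigma_algebra; exists s; first by rewrite /= in_itv/= s0.
by exists B => //; rewrite setTI.
Qed.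

HB.instance Definition _ t :=
  isMeasurableFun.Build _ _ _ _ (path_at t) (measurable_path_at t).

End coordinates.

Lemma ae_eq_measure d (T : measurableType d) (R : realType)
    (mu : {measure set T -> \bar R}) (A B : set T) :
  measurable A -> measurable B -> {ae mu, forall x, A x <-> B x} -> mu A = mu B.
Proof.
move=> mA mB [N [mN N0 HN]].
have AB : A `<=` B `|` N.
  by move=> x Ax; have [ABx|/HN] := pselect (A x <-> B x); [left; exact/ABx|right].
have BA : B `<=` A `|` N.
  by move=> x Bx; have [ABx|/HN] := pselect (A x <-> B x); [left; exact/ABx|right].
apply/eqP; rewrite eq_le -{1}(measureU0 mB mN N0) -{2}(measureU0 mA mN N0).
by rewrite !le_measure ?inE//; exact: measurableU.
Qed.

(** * Increments of the Lévy process and stochastic continuity *)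

Section levy_marginals.
Variables (R : realType) (PX : probability (skorohod R) R).
Hypothesis X_levy : levy PX.
Local Notation mu t := (distribution PX (path_at t)).

(** A product measure is determined by rectangles. On these, independence and stationarity of the
    increments over the times [0, s, s + t] give the product, since [w s - w 0] is almost surely
    [w s]. *)
Lemma levy_increment_law (s t : R) (D : set (R * R)) : 0 <= s -> 0 <= t ->
  measurable D ->
  PX [set w | D (w s, w (s + t) - w s)] = (mu s \x mu t)%E D.
Proof.
move=> s0 t0 mD.
have mphi : measurable_fun setT
    (fun w : skorohod R => (path_at s w, path_at (s + t) w - path_at s w)).
  apply/measurable_fun_pair; first exact: measurable_path_at.
  by apply: measurable_funB; exact: measurable_path_at.
apply/esym.
apply: (@product_measure_unique _ _ _ _ R (mu s) (mu t) (pushforward PX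
  (fun w : skorohod R => (path_at s w, path_at (s + t) w - path_at s w)))) =>
  // A B mA mB.
have [X0 Xind Xstat] := X_levy.
rewrite /distribution /= /pushforward.
pose BB i := if i is 0%N then A else B.
have := Xind 2 (fun i => [:: 0; s; s + t]`_i) BB (lexx _).
have H1 i : (i < 2)%N -> [:: 0; s; s + t]`_i <= [:: 0; s; s + t]`_i.+1.
  by case: i => [|[|]]//= _; rewrite lerDl.
have H2 i : (i < 2)%N -> measurable (BB i) by case: i => [|[|]].
move=> /(_ H1 H2).
rewrite !big_ord_recl big_ord0 mule1 /= (Xstat s t B)//.
have := Xstat 0 s A (lexx _) s0 mA; rewrite add0r => -> H.
rewrite -[RHS]H; apply: ae_eq_measure.
- by rewrite -[X in measurable X]setTI; apply: mphi => //; exact: measurableX.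
- rewrite [X in measurable X](_ : _ =
    [set w | A (path_at s w - path_at 0 w)] `&`
    [set w | B (path_at (s + t) w - path_at s w)]); last first.
    apply/seteqP; split => [w H'|w [? ?] [|[|]]//].
    by split; [exact: (H' 0%N)|exact: (H' 1%N)].
  by apply: measurableI; rewrite -[X in measurable X]setTI;
    apply: measurable_funB => //; exact: measurable_path_at.
- apply: filterS X0 => w w0; rewrite /= /path_at; split => [[? ?]|H'].
    by move=> [|[|]]//= _; rewrite w0 subr0.
  by split; [have := H' 0%N isT; rewrite /= w0 subr0|exact: (H' 1%N)].
Qed.

(** Otherwise there are times [u n] decreasing below every bound at which [X] exceeds [eta] in
    absolute value with probability above [e]. Then this happens infinitely often with probability
    at least [e], against right continuity at [0]. *)
Lemma levy_stochastic_continuity (eta e : R) : 0 < eta -> 0 < e ->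
  exists2 del, 0 < del & forall s, 0 < s -> s < del ->
    (PX [set w | (eta <= `|w s|)%R] <= e%:E)%E.
Proof.
move=> eta0 e0; apply: contrapT => H.
have {}H n : exists s, [/\ 0 < s, s < n.+1%:R^-1 &
    (e%:E < PX [set w | (eta <= `|w s|)%R])%E].
  apply: contrapT => /forallNP H'; apply: H; exists n.+1%:R^-1 => // s s0 sn.
  by rewrite leNgt; apply/negP => es; apply: (H' s).
have {H} [u H] := choice H.
pose F n := [set w : skorohod R | eta <= `|path_at (u n) w|].
have mF n : measurable (F n).
  rewrite /F -[X in measurable X]setTI.
  apply: (@measurable_fun_le _ _ _ _ (cst eta) (fun w => `|path_at (u n) w|)) => //.
  by apply: measurableT_comp => //; exact: measurable_path_at.
have mU n : measurable (\bigcup_(k >= n) F k) by exact: bigcup_measurable.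
(* The limsup is the decreasing limit of the unions of the [F k], [k >= n], and the [n]-th union
   contains [F n]. *)
have: (e%:E <= PX (lim_sup_set F))%E.
  have cv := lim_sup_set_cvg PX F mF.
  rewrite -(cvg_lim _ (cv _))//; last first.
    by rewrite (le_lt_trans (probability_le1 _ _))// ltry.
  apply: lime_ge; first by apply/cvg_ex; eexists; apply: cv;
    rewrite (le_lt_trans (probability_le1 _ _))// ltry.
  apply: nearW => n; have [_ _ /ltW/le_trans] := H n; apply.
  apply: le_measure; rewrite ?inE; [exact: (mF n)|exact: mU|].
  by move=> w Fw; exists n => /=.
apply/negP; rewrite -ltNge (_ : PX _ = 0%E) ?lte_fin//.
have [X0 _ _] := X_levy.
apply/negligibleP.
  by apply: bigcapT_measurable => n; exact: mU.
apply: negligibleS X0 => w Fw /= w0.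
have := @cadlag_right _ w 0 (lexx _); rewrite w0.
move=> /cvgr0Pnorm_lt/(_ _ eta0); rewrite near_withinE near_simpl.
move=> /nbhs_ballP[del /= del0 Hdel].
have [n _ ndel] : \forall n \near \oo, n.+1%:R^-1 < del.
  exact: near_infty_natSinv_lt (PosNum del0).
have [k /= nk] := Fw n I.
rewrite /F /= leNgt => /negP; apply; have [u0 un _] := H k.
apply: Hdel => //; rewrite /ball/= sub0r normrN gtr0_norm//.
by apply: lt_trans un _; exact: ndel.
Qed.

End levy_marginals.

Lemma lt_bigcup_nondecreasing d (T : measurableType d) (R : realType)
    (mu : {measure set T -> \bar R}) (F : (set T)^nat) (c : \bar R) :
  (forall n, measurable (F n)) -> nondecreasing_seq F ->
  (c < mu (\bigcup_n F n) -> exists n, c < mu (F n))%E.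
Proof.
move=> mF ndF; apply: contraPP => /forallNP H; apply/negP; rewrite -leNgt.
have cv := nondecreasing_cvg_mu (mu := mu) mF (bigcupT_measurable _ mF) ndF.
rewrite -(cvg_lim _ cv)//; apply: lime_le; first by apply/cvg_ex; eexists; exact: cv.
by apply: nearW => n; rewrite leNgt; apply/negP; exact: H.
Qed.

(** * Densities of the marginals and joint laws at two times *)

Section levy_densities.
Variables (R : realType) (PX : probability (skorohod R) R).
Variable f : R -> R -> \bar R.
Hypotheses (X_levy : levy PX) (X_density : levy_density PX f).
Local Notation mu t := (distribution PX (path_at t)).
Local Notation leb := (@lebesgue_measure R).

Lemma levy_marginal_dominated (t : R) : 0 < t -> mu t `<< leb.
Proof.
move=> t0; apply/null_content_dominatesP => A mA A0.
have [mf _ fE] := X_density t0.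
have -> : mu t A = (\int[leb]_(x in A) f t x)%E by rewrite -fE.
by apply: null_set_integral => //; exact: measurable_funTS.
Qed.

(* [X_t = X_(t - s) + (X_t - X_(t - s))] with independent terms, and the last
   one has the law of [X_s]; translation invariance does the rest. *)
Lemma levy_uniformly_dominated (s e : R) : 0 < s -> 0 < e ->
  exists2 del, 0 < del & forall t A, s <= t -> measurable A ->
    (leb A < del%:E)%E -> (mu t A <= e%:E)%E.
Proof.
move=> s0 e0.
have [del del0 H] :=
  @lebesgue_dominates_continuous R (mu s) (levy_marginal_dominated s0) _ e0.
exists del => // t A st mA Adel.
have ts0 : 0 <= t - s by rewrite subr_ge0.
pose D := [set xy : R * R | A (xy.1 + xy.2)].
have mD : measurable D.
  rewrite -[D]setTI; apply: (measurable_funD (f := fst) (g := snd)) => //.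
have -> : mu t A = PX [set w | D (w (t - s), w (t - s + s) - w (t - s))].
  rewrite /D/= /distribution /pushforward; congr (PX _).
  by apply/seteqP; split=> w /=; rewrite addrC !subrK.
rewrite (levy_increment_law X_levy)// ?(ltW s0)// /product_measure1.
rewrite -[e%:E]mule1 -(probability_setT (mu (t - s))) -integral_cst//.
apply: ge0_le_integral => //.
- exact: measurable_fun_xsection.
- move=> x _; apply/ltW/H.
    exact: measurable_xsection.
  rewrite (_ : xsection _ _ = [set y | A (y + x)]); last first.
    by apply/seteqP; split=> y; rewrite /xsection/= inE/= addrC.
  by rewrite lebesgue_measure_shift.
Qed.

(* The hypothesis says that the joint density [f_t(z - x)] of
   [(X_s, X_(s + t))] with respect to [mu_s(dx) dz] vanishes on [A * C]. *)
Lemma levy_two_times_null (s t : R) (A C : set R) : 0 <= s -> 0 < t ->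
  measurable A -> measurable C ->
  (forall z, C z -> (\int[mu s]_(x in A) f t (z - x)%R = 0)%E) ->
  PX [set w | A (w s) /\ C (w (s + t))] = 0%E.
Proof.
move=> s0 t0 mA mC ACf.
have [mf f0 fE] := X_density t0.
pose D := [set xy : R * R | A xy.1 /\ C (xy.1 + xy.2)].
have mD : measurable D.
  apply: measurableI; first by rewrite -[X in measurable X]setTI; apply: measurable_fst.
  rewrite -[X in measurable X]setTI; apply: (measurable_funD (f := fst) (g := snd)) => //.
transitivity (PX [set w | D (w s, w (s + t) - w s)]).
  have E (w : skorohod R) : w s + (w (s + t) - w s) = w (s + t) by rewrite addrC subrK.
  by congr (PX _); apply/seteqP; split=> w; rewrite /D/= E.
rewrite (levy_increment_law X_levy)// ?(ltW t0)// /product_measure1.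
(* The joint density restricted to [A] times [C], written on the whole plane so that Tonelli
   applies. *)
pose g (x z : R) := ((\1_A x)%:E * (\1_C z)%:E * f t (z - x)%R)%E.
have mg : measurable_fun setT (fun xz : R * R => g xz.1 xz.2).
  apply: emeasurable_funM.
    apply: emeasurable_funM; apply/measurable_EFinP.
      by apply: (@measurableT_comp _ _ _ _ _ _ (\1_A : R -> R) _ fst) => //;
        exact: measurable_indic.
    by apply: (@measurableT_comp _ _ _ _ _ _ (\1_C : R -> R) _ snd) => //;
      exact: measurable_indic.
  apply: (measurableT_comp (f := f t)) => //.
  exact: measurable_funB.
have g0 x z : (0 <= g x z)%E by rewrite /g !mule_ge0// lee_fin.
transitivity (\int[mu s]_x \int[leb]_z g x z)%E.
  apply: eq_integral => x _ /=.
  have mgx : measurable_fun setT (g x).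
    exact: (measurableT_comp mg (measurable_pair1 x)).
  (* Passes from the endpoint [z] to the increment [y], with [z = y + x]. *)
  rewrite -(ge0_integral_shift x)//.
  have -> : mu t (xsection D x) = (\int[leb]_(y in xsection D x) f t y)%E.
    by rewrite -fE//; exact: measurable_xsection.
  rewrite integral_mkcond; apply: eq_integral => y _.
  rewrite /g addrK patchE mem_xsection !indicE.
  have -> : ((x, y) \in D) = (x \in A) && (y + x \in C).
    by apply/idP/andP; rewrite !inE /D/= addrC.
  by case: (x \in A); case: (y + x \in C); rewrite /= ?mul1e ?mul0e.
rewrite (@fubini_tonelli _ _ _ _ R (mu s) leb (fun xz => g xz.1 xz.2))//.
rewrite integral0_eq// => z _.
have [Cz|Cz] := boolP (z \in C); last first.
  rewrite integral0_eq// => x _.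
  by rewrite /g [X in (_ * X%:E * _)%E]indicE (negbTE Cz) mule0 mul0e.
rewrite -[RHS](ACf z); last by rewrite inE in Cz.
rewrite [RHS]integral_mkcond; apply: eq_integral => x _.
rewrite /g patchE !indicE Cz mule1.
by case: (x \in A); rewrite ?mul1e ?mul0e.
Qed.

(* [A] is enclosed in an open set [U] with [U \ A] small.  Since
   [X_r - X_t -> 0] in probability, [X_r \in A] forces [X_t \in U] up to a small
   probability, and [X_t \in U \ A] is unlikely uniformly in [t]. *)
Lemma levy_two_times_pos (s r : R) (A : set R) : 0 < s ->
  measurable A -> (0 < mu r A)%E ->
  exists2 del, 0 < del & forall t, s <= t -> r - del < t -> t < r ->
    PX [set w | A (w t) /\ A (w r)] <> 0%E.
Proof.
move=> s0.
have mtwo t u (B C : set R) : measurable B -> measurable C ->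
    measurable [set w : skorohod R | B (w t) /\ C (w u)].
  move=> mB mC; apply: measurableI.
    by rewrite -[X in measurable X]setTI; exact: measurable_path_at.
  by rewrite -[X in measurable X]setTI; exact: measurable_path_at.
(* Outer regularity requires finite Lebesgue measure. Some truncation of [A] to [[-n, n]] still has
   positive probability, and the claim for a subset implies it for [A]. *)
wlog Afin : A / (leb A < +oo)%E => [wlogA|] mA A0.
  pose F n := A `&` [set` `[- n%:R, n%:R]] : set R.
  have mF n : measurable (F n) by exact: measurableI.
  have [n Fn] : exists n, (0 < mu r (F n))%E.
    apply: (lt_bigcup_nondecreasing mF).
      move=> m n mn; apply/subsetPset => x [Ax]; rewrite /= !in_itv/=.
      move=> /andP[mx xm]; split => //=; rewrite in_itv/=.
      by rewrite (le_trans _ mx) ?lerN2 ?ler_nat// (le_trans xm)// ler_nat.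
    rewrite (_ : \bigcup_n F n = A)//; apply/seteqP; split => [x [n _ []]//|x Ax].
    exists (Num.truncn `|x|).+1 => //; split=> //=.
    by rewrite in_itv/= -ler_norml ltW// truncnS_gt.
  have FnA : F n `<=` A by move=> x [].
  have Fnoo : (leb (F n) < +oo)%E.
    apply: (le_lt_trans (y := leb [set` `[- n%:R, n%:R]%R])).
      by apply: le_measure; rewrite ?inE; [exact: mF|exact: measurable_itv|move=> x []].
    by rewrite lebesgue_measure_itv/=; case: ifP => _; rewrite -?EFinB ltry.
  have [del del0 H] := wlogA _ Fnoo (mF n) Fn.
  exists del => // t st tr1 tr2 P0; apply: (H t) => //.
  apply: (subset_measure0 _ _ _ P0); [exact: mtwo|exact: mtwo|].
  by move=> w [/FnA ? /FnA].
have mu_fin : mu r A \is a fin_num by rewrite fin_num_measure.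
(* Two errors of size [p] will occur; their sum [2 * p] is half of the probability of [{X_r \in A}],
   which leaves room for the loss from [A] to [A] intersected with [E n]. *)
pose p := fine (mu r A) / 4.
have p0 : 0 < p by rewrite divr_gt0// fine_gt0// A0/= ltey_eq mu_fin.
have [del1 del10 H1] := levy_uniformly_dominated s0 p0.
have [U [oU AU UA]] := lebesgue_regularity_outer mA Afin del10.
have mU : measurable U by exact: open_measurable.
(* The points at distance at least [1 / (n + 1)] from the complement of [U]. These closed sets
   increase to [U], since [U] is open. *)
pose E n := [set x : R | ball x n.+1%:R^-1 `<=` U].
have mE n : measurable (E n).
  rewrite -[E n]setCK; apply: measurableC; apply: open_measurable.
  rewrite (_ : ~` _ = \bigcup_(y in ~` U) ball y n.+1%:R^-1); last first.
    apply/seteqP; split => [x /existsNP[y /not_implyP[xy Uy]]|x [y Uy xy] /(_ y)].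
      by exists y => //; exact: ball_sym.
    by move/(_ (ball_sym xy)).
  by apply: bigcup_open => y _; exact: ball_open.
have [n En] : exists n, ((2 * p)%:E < mu r (A `&` E n))%E.
  apply: (@lt_bigcup_nondecreasing _ _ R (mu r) (fun n => A `&` E n)).
  - by move=> n; exact: measurableI.
  - move=> m n mn; apply/subsetPset => x [Ax Ex]; split=> // y xy; apply: Ex.
    by apply: le_ball xy; rewrite lef_pV2 ?posrE// ler_nat.
  - rewrite -setI_bigcupr (_ : A `&` _ = A).
      apply: (@lt_le_trans _ _ (fine (mu r A))%:E); last by rewrite fineK.
      rewrite lte_fin /p mulrA ltr_pdivrMr// mulrC ltr_pM2l//.
        by rewrite ltr_nat.
      by rewrite fine_gt0// A0/= ltey_eq mu_fin.
    apply/setIidPl => x /AU Ux.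
    have /nbhs_ballP[e /= e0 xeU] := open_nbhs_nbhs (conj oU Ux).
    have [n _ nde] : \forall n \near \oo, n.+1%:R^-1 < e.
      exact: near_infty_natSinv_lt (PosNum e0).
    exists n => // y xy; apply: xeU; apply: le_ball xy; exact/ltW/nde/leqnn.
have n0 : 0 < n.+1%:R^-1 :> R by rewrite invr_gt0.
have [del2 del20 H2] := levy_stochastic_continuity X_levy n0 p0.
exists del2 => // t st rt tr P0.
have t0 : 0 <= t by rewrite (le_trans _ st)// ltW.
have H3 : (PX [set w | (n.+1%:R^-1 <= `|w r - w t|)%R] <= p%:E)%E.
  have [_ _ Xstat] := X_levy.
  have := Xstat t (r - t) [set x | n.+1%:R^-1 <= `|x|] t0.
  rewrite subr_ge0 (addrC t) subrK => /(_ (ltW tr)) ->.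
    by apply: H2; rewrite ?subr_gt0// ltrBlDr -ltrBlDl.
  rewrite -[X in measurable X]setTI.
  by apply: (@measurable_fun_le _ _ _ _ (cst n.+1%:R^-1) (fun x : R => `|x|)) => //;
    exact: measurable_normr.
have H4 : (mu t (U `\` A) <= p%:E)%E by apply: H1 => //; exact: measurableD.
(* If [X_r] is in [A] and [E n], then either the increment is at least [1 / (n + 1)], or [X_t] is in
   [U], hence in [A] or in [U] minus [A]. The case [X_t \in A] is null by [P0]; each of the other
   two costs at most [p]. *)
have : (mu r (A `&` E n) <= (2 * p)%:E)%E.
  rewrite mulr2n mulrDl mul1r EFinD; apply: le_trans (leeD H4 H3).
  rewrite -[leRHS]add0e -[X in (X + _)%E]P0.
  have mUA : measurable (path_at t @^-1` (U `\` A)).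
    by rewrite -[X in measurable X]setTI; apply: measurable_path_at => //;
      exact: measurableD.
  have mrt : measurable [set w : skorohod R | n.+1%:R^-1 <= `|w r - w t|].
    rewrite -[X in measurable X]setTI.
    apply: (@measurable_fun_le _ _ _ _ (cst n.+1%:R^-1)
      (fun w => `|path_at r w - path_at t w|)) => //.
    by apply: measurableT_comp => //; apply: measurable_funB;
      exact: measurable_path_at.
  apply: le_trans (leeD (lexx _) (measureU2 _ mUA mrt)).
  apply: le_trans (measureU2 _ (mtwo t r A A mA mA) (measurableU _ _ mUA mrt)).
  rewrite -[leLHS]/(PX (path_at r @^-1` (A `&` E n))).
  apply: le_measure; rewrite ?inE.
  - by rewrite -[X in measurable X]setTI; apply: measurable_path_at => //;
      exact: measurableI.
  - by apply: measurableU; [exact: mtwo|exact: measurableU].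
  move=> w [Ar Er] /=.
  have [|wrt] := leP n.+1%:R^-1 `|w r - w t|; first by right; right.
  have [|At] := pselect (A (w t)); first by left.
  by right; left; split=> //; exact: Er.
by rewrite leNgt En.
Qed.

End levy_densities.

(** * Completed sigma-algebras, conditional laws and non-degenerate variables *)

Section completion.
Context d (Omega : measurableType d) (R : realType) (P : probability Omega R).

(** The events on the right form a sigma-algebra containing both kinds of generators. Conversely,
    such an [E] differs from the preimage of [B] only inside a null set, all of whose subsets are
    generators. *)
Lemma completed_sigmaP (g : Omega -> R) (E : set Omega) :
  <<s preimage_set_system setT g (@measurable _ R) `|` P.-negligible >> E <->
  exists2 B : set R, measurable B & {ae P, forall w, E w <-> B (g w)}.
Proof.
set G := _ `|` _; split; last first.
  move=> [B mB EB]; pose D := [set w | ~ (E w <-> B (g w))].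
  have sD C : C `<=` D -> <<s G >> C.
    by move=> CD; apply: sub_sigma_algebra; right; exact: negligibleS EB.
  have -> : E = (g @^-1` B `\` D) `|` (E `&` D).
    apply/seteqP; split => w.
      move=> Ew; have [Dw|nDw] := pselect (D w); [by right|left; split=> //].
      by have [+ _] := contrapT nDw; apply.
    by move=> [[Bw /contrapT[_]]|[]//]; apply.
  apply: (@measurableU _ (g_sigma_algebraType G)); last by apply: sD; exact: subIsetr.
  apply: (@measurableD _ (g_sigma_algebraType G)); last exact: sD.
  by apply: sub_sigma_algebra; left; exists B => //; rewrite setTI.
move: E; apply: smallest_sub.
  split.
  - by exists set0 => //; apply: aeW.
  - move=> A [B mB AB]; exists (~` B); first exact: measurableC.
    apply: filterS AB => w [AB BA] /=; split => [[_ nA] /BA//|nB].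
    by split=> // /AB.
  - move=> A /(_ _)/cid2-/all_sig2[B mB AB].
    exists (\bigcup_n B n); first exact: bigcupT_measurable.
    have := @ae_foralln _ _ _ P _ AB.
    by apply: filterS => w H; split => -[n _ Hn]; exists n => //; exact/(H n).
move=> E [[B mB <-]|nE].
  by exists B => //; apply: aeW => w; rewrite setTI.
exists set0 => //; apply: negligibleS nE => w /= H.
by apply: contrapT => nEw; apply: H; split.
Qed.

Lemma conditional_distribution_null d1 d2 (T1 : measurableType d1)
    (T2 : measurableType d2) (Y : {RV P >-> T1}) (V : {mfun Omega >-> T2})
    (k : R.-pker T2 ~> T1) (A : set T2) (B : set T1) :
  conditional_distribution Y V k -> measurable A -> measurable B ->
  P (V @^-1` A `&` Y @^-1` B) = 0%E <->
  {ae distribution P V, forall v, A v -> k v B = 0%E}.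
Proof.
move=> YVk mA mB; rewrite (YVk _ _ mA mB).
have mk : measurable_fun A (fun v => k v B).
  by apply: measurable_funTS; exact: measurable_kernel.
have := @ae_eq_integral_abs _ _ _ (distribution P V) A mA _ mk.
by under eq_integral do rewrite gee0_abs//.
Qed.

Lemma independent_RV_product d1 d2 (T1 : measurableType d1)
    (T2 : measurableType d2) (X : {RV P >-> T1}) (Y : {RV P >-> T2})
    (D : set (T1 * T2)) :
  independent_RV X Y -> measurable D ->
  distribution P (pair_RV X Y) D = (distribution P X \x distribution P Y)%E D.
Proof.
by move=> XY mD; apply/esym; apply: product_measure_unique.
Qed.

(** If every level [t] had a null side, [X] would almost surely equal the supremum of the levels [t]
    with [P(X <= t) = 0]. *)
Lemma not_ae_constant (X : {RV P >-> R}) :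
  (~ exists r : R, {ae P, forall w, X w = r}) ->
  exists t : R, P [set w | X w <= t] <> 0%E /\ P [set w | t < X w] <> 0%E.
Proof.
move=> Xr; apply: contrapT => /forallNP H; apply: Xr.
have mle t : measurable [set w | X w <= t].
  rewrite -[X in measurable X]setTI.
  exact: (@measurable_fun_le _ _ _ _ X (cst t)).
have mgt t : measurable [set w | t < X w].
  rewrite (_ : mkset _ = ~` [set w | X w <= t]); first exact: measurableC.
  by apply/seteqP; split=> w /=; rewrite ltNge => /negP.
have {}H t : P [set w | X w <= t] = 0%E \/ P [set w | t < X w] = 0%E.
  by have /not_andP[/contrapT|/contrapT] := H t; [left|right].
pose S := [set t | P [set w | X w <= t] = 0%E].
have P1 : P setT <> 0%E by rewrite probability_setT => /eqP; rewrite eqe oner_eq0.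
have S0 : S !=set0.
  apply: contrapT => /forallNP S0; apply: P1.
  rewrite (_ : setT = \bigcup_n [set w | - n%:R < X w]); last first.
    apply/seteqP; split=> // w _; exists (Num.truncn `|X w|).+1 => //=.
    by rewrite ltrNl (le_lt_trans _ (truncnS_gt _))// -normrN ler_norm.
  apply/negligibleP; first exact: bigcupT_measurable.
  apply: negligible_bigcup => n; apply/negligibleP => //.
  by case: (H (- n%:R)) => // /S0.
have Sub : exists t, ~ S t.
  apply: contrapT => /forallNP St; apply: P1.
  rewrite (_ : setT = \bigcup_n [set w | X w <= n%:R]); last first.
    apply/seteqP; split=> // w _; exists (Num.truncn `|X w|).+1 => //=.
    by rewrite (le_trans (ler_norm _))// ltW// truncnS_gt.
  apply/negligibleP; first exact: bigcupT_measurable.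
  apply: negligible_bigcup => n; apply/negligibleP => //.
  by apply: contrapT; exact: St.
have Sdown s t : s <= t -> S t -> S s.
  move=> st; apply: subset_measure0 => //.
  by move=> w /= /le_trans; exact.
have hS : has_sup S.
  split => //; have [t St] := Sub; exists t => s Ss.
  by rewrite leNgt; apply/negP => /ltW ts; apply: St; exact: Sdown Ss.
exists (sup S).
have H1 n : P.-negligible [set w | X w <= sup S - n.+1%:R^-1].
  apply/negligibleP => //.
  have e0 : 0 < n.+1%:R^-1 :> R by rewrite invr_gt0.
  have [s Ss ss] := sup_adherent e0 hS.
  exact: Sdown (ltW ss) Ss.
have H2 n : P.-negligible [set w | sup S + n.+1%:R^-1 < X w].
  apply/negligibleP => //.
  case: (H (sup S + n.+1%:R^-1)) => // /(sup_upper_bound hS).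
  by rewrite gerDl leNgt invr_gt0 ltr0n.
apply: negligibleS (negligibleU (negligible_bigcup H1) (negligible_bigcup H2)).
move=> w /= /eqP; rewrite neq_lt => /orP[Xw|Xw].
  left; have d0 : 0 < sup S - X w by rewrite subr_gt0.
  have [n _ Hn] := near_infty_natSinv_lt (PosNum d0).
  exists n => //=; rewrite lerBrDr -lerBrDl; exact/ltW/Hn/leqnn.
right; have d0 : 0 < X w - sup S by rewrite subr_gt0.
have [n _ Hn] := near_infty_natSinv_lt (PosNum d0).
by exists n => //=; rewrite -ltrBrDl; exact/Hn/leqnn.
Qed.

End completion.

(** * Null events of deterministic bridges at a fixed time *)

Section bridges.
Variables (R : realType) (PX : probability (skorohod R) R).
Variable f : R -> R -> \bar R.
Hypothesis X_density : levy_density PX f.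
Local Notation mu t := (distribution PX (path_at t)).

(** At time [t] the bridge has density [f (r - t) (z - x) / f r z] with respect to the law of [X_t].
    The denominator is positive and finite, so it does not affect null sets. *)
Lemma bridge_marginal (r z t : R) (Q : {measure set (skorohod R) -> \bar R})
    (B : set R) :
  extended_bridge_law PX f r z Q -> (0 < f r z < +oo)%E -> 0 <= t -> t < r ->
  measurable B ->
  Q (path_at t @^-1` B) = 0%E <-> (\int[mu t]_(x in B) f (r - t) (z - x)%R = 0)%E.
Proof.
move=> [QB _] /andP[frz0 frzoo] t0 tr mB.
have rt0 : 0 < r - t by rewrite subr_gt0.
have [mf f0 _] := X_density rt0.
have mfz : measurable_fun setT (fun x : R => f (r - t) (z - x)).
  by apply: measurableT_comp => //; exact: measurable_funB.
have frzE : f r z = (fine (f r z))%:E by rewrite fineK// ge0_fin_numE ?ltW.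
have frz_gt0 : 0 < fine (f r z) by rewrite fine_gt0// frz0.
have -> : Q (path_at t @^-1` B) =
    ((\int[mu t]_(x in B) f (r - t) (z - x)%R) * (fine (f r z))^-1%:E)%E.
  rewrite (QB t)//; last exact: coord_filtration_path_at.
  rewrite frzE inver gt_eqF//.
  rewrite -ge0_integralZr//; last 2 first.
  - exact: measurable_funTS.
  - by rewrite lee_fin invr_ge0 ltW.
  rewrite ge0_integral_pushforward//.
  - by apply: measurable_funTS; apply: emeasurable_funM.
  - by move=> x _; rewrite mule_ge0// lee_fin invr_ge0 ltW.
split=> [/eqP|->]; last by rewrite mul0e.
rewrite mule_eq0 => /orP[/eqP//|].
by rewrite eqe invr_eq0 gt_eqF.
Qed.

Lemma bridge_pinned (r z t : R) (Q : {measure set (skorohod R) -> \bar R})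
    (B : set R) :
  extended_bridge_law PX f r z Q -> r <= t -> measurable B -> ~ B z ->
  Q (path_at t @^-1` B) = 0%E.
Proof.
move=> [_ Qz] rt mB Bz; apply/negligibleP.
  by rewrite -[X in measurable X]setTI; exact: measurable_path_at.
apply: negligibleS Qz => w Bw /= wz; apply: Bz.
by rewrite -(wz t rt).
Qed.

End bridges.

(** * Null events of the random bridge, read on the law of [(tau, Z)] *)

Section levy_bridge.
Context d (Omega : measurableType d) (R : realType) (P : probability Omega R).
Variables (PX : probability (skorohod R) R) (f : R -> R -> \bar R).
Hypothesis X_density : levy_density PX f.
Variables (tau Z : {RV P >-> R}) (zeta : {RV P >-> skorohod R}).
Hypothesis zeta_bridge : levy_bridge PX f tau Z zeta.
Local Notation mu t := (distribution PX (path_at t)).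
Local Notation V := (pair_RV tau Z).

Let mle (t : R) : measurable [set v : R * R | v.1 <= t].
Proof.
rewrite -[X in measurable X]setTI.
exact: (@measurable_fun_le _ _ _ _ fst (cst t)).
Qed.

Let mgt (t : R) : measurable [set v : R * R | t < v.1].
Proof.
rewrite (_ : mkset _ = ~` [set v : R * R | v.1 <= t]); first exact: measurableC.
by apply/seteqP; split=> w /=; rewrite ltNge => /negP.
Qed.

Let mpath (t : R) (B : set R) : measurable B ->
  measurable (path_at t @^-1` B : set (skorohod R)).
Proof. by move=> mB; rewrite -[X in measurable X]setTI; exact: measurable_path_at. Qed.

(** From time [tau] on the bridge sits at [Z]. *)
Lemma levy_bridge_after (t : R) (B : set R) : measurable B ->
  P [set w | tau w <= t /\ B (zeta w t)] = 0%E <->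
  {ae distribution P V, forall v, v.1 <= t -> ~ B v.2}.
Proof.
move=> mB; have [fpos [k [kV kbridge]]] := zeta_bridge.
rewrite (conditional_distribution_null kV (mle t) (mpath t mB)).
split; apply: filterS2 kbridge => v kv kv0 vt; last first.
  by apply: (bridge_pinned kv vt mB); exact: kv0.
(* With [v.2] in [B], both the event and its complement would be null for the probability [k v]. *)
move=> Bv; have := @prob_kernel _ _ _ _ _ k v.
have mBt := mpath t mB; have mBtC := measurableC mBt.
rewrite -(setvU (path_at t @^-1` B)) (measureU0 mBtC mBt (kv0 vt)).
rewrite (bridge_pinned kv vt (measurableC mB))//.
by move=> /eqP; rewrite eqe eq_sym oner_eq0.
Qed.

Lemma levy_bridge_before (t : R) (B : set R) : 0 <= t -> measurable B ->
  P [set w | t < tau w /\ B (zeta w t)] = 0%E <->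
  {ae distribution P V, forall v, t < v.1 ->
     (\int[mu t]_(x in B) f (v.1 - t) (v.2 - x)%R = 0)%E}.
Proof.
move=> t0 mB; have [fpos [k [kV kbridge]]] := zeta_bridge.
rewrite (conditional_distribution_null kV (mgt t) (mpath t mB)).
have H : {ae distribution P V, forall v, t < v.1 -> 
   (k v (path_at t @^-1` B) = 0%E <->
    (\int[mu t]_(x in B) f (v.1 - t) (v.2 - x)%R = 0)%E)}.
  apply: filterS2 fpos kbridge => v [fv0 fvoo] kv vt.
  by apply: (bridge_marginal X_density kv) => //; rewrite fv0.
by split; apply: filterS2 H => v H Hv vt; apply/(H vt); exact: Hv.
Qed.

End levy_bridge.

(** * The characterization of [a_ac = 0] *)

(** If [tau] is almost surely constant, each event [{tau <= t}] is null or of full probability and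
    lies in the completed sigma-algebra whatever the law of [Z]; hence the non-constancy assumption
    in the converse. *)
Theorem proposition2p6 (R : realType) (d : measure_display)
    (Omega : measurableType d) (P : probability Omega R)
    (P_complete : measure_is_complete P)
    (PX : probability (skorohod R) R) (f : R -> R -> \bar R)
    (X_levy : levy PX) (X_density : levy_density PX f)
    (tau Z : {RV P >-> R})
    (tau_gt0 : forall w, 0 < tau w)
    (tau_Z_indep : independent_RV tau Z)
    (zeta : {RV P >-> skorohod R})
    (zeta_bridge : levy_bridge PX f tau Z zeta)
    (PZs PZac : probability R R) (a_ac : R)
    (Z_decomp : lebesgue_decomposition (distribution P Z) PZs PZac a_ac) :
  (a_ac = 0 ->
    forall t : R, 0 < t -> completed_sigma_at zeta t [set w | tau w <= t]) /\
  ((~ exists r : R, {ae P, forall w, tau w = r}) ->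
    (forall t : R, 0 < t -> completed_sigma_at zeta t [set w | tau w <= t]) ->
    a_ac = 0).
Proof.
have [/andP[a0 a1] [N [mN PZsN lebN]] PZac_leb PZE] := Z_decomp.
pose V := pair_RV tau Z.
have mtau (t : R) : measurable [set w | tau w <= t].
  rewrite -[X in measurable X]setTI.
  exact: (@measurable_fun_le _ _ _ _ tau (cst t)).
have mtauC (t : R) : measurable [set w | t < tau w].
  rewrite (_ : mkset _ = ~` [set w | tau w <= t]); first exact: measurableC.
  by apply/seteqP; split=> w /=; rewrite ltNge => /negP.
have mzeta (t : R) B : measurable B -> measurable [set w | B (zeta w t)].
  move=> mB; rewrite -[X in measurable X]setTI.
  exact: (measurableT_comp (measurable_path_at t) (measurable_funPT zeta)).
have mZ B : measurable B -> measurable (Z @^-1` B).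
  by move=> mB; rewrite -[X in measurable X]setTI; exact: measurable_funPT.
have pair_ae_snd C : measurable C -> P (Z @^-1` (~` C)) = 0%E ->
    {ae distribution P V, forall v, C v.2}.
  move=> mC PZC; exists (setT `*` ~` C); split.
  - by apply: measurableX => //; exact: measurableC.
  - by rewrite -[RHS]PZC; congr (P _); apply/seteqP; split=> w // [].
  - by move=> v; split.
split.
  move=> aE t t0; apply/completed_sigmaP; exists N => //.
  have PZN : P (Z @^-1` (~` N)) = 0%E.
    have := PZE _ (measurableC mN).
    by rewrite aE subr0 mul1e mul0e adde0 PZsN.
  have Zae := pair_ae_snd N mN PZN.
  have after : P [set w | tau w <= t /\ (~` N) (zeta w t)] = 0%E.
    apply/(levy_bridge_after zeta_bridge _ (measurableC mN)).
    by apply: filterS Zae => v Nv _; exact.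
  have before : P [set w | t < tau w /\ N (zeta w t)] = 0%E.
    apply/(levy_bridge_before X_density zeta_bridge (ltW t0) mN).
    apply: aeW => v tv; apply: null_set_integral => //.
    - apply: measurable_funTS.
      have [mf _ _] := X_density (v.1 - t) ltac:(by rewrite subr_gt0).
      by apply: (measurableT_comp mf); exact: measurable_funB.
    - have /null_content_dominatesP := levy_marginal_dominated X_density t0.
      exact.
  have nafter : P.-negligible [set w | tau w <= t /\ (~` N) (zeta w t)].
    apply/negligibleP; last exact: after.
    by apply: measurableI; [exact: mtau|exact: (mzeta _ _ (measurableC mN))].
  have nbefore : P.-negligible [set w | t < tau w /\ N (zeta w t)].
    apply/negligibleP; last exact: before.
    by apply: measurableI; [exact: mtauC|exact: mzeta].
  (* The two null events cover the symmetric difference of [{tau <= t}] and [{zeta_t \in N}]. *)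
  apply: negligibleS (negligibleU nafter nbefore) => w /= H.
  have [taut|taut] := leP (tau w) t; last first.
    right; split=> //; apply: contrapT => Nw; apply: H; split=> //.
    by rewrite leNgt taut.
  by left; split=> // Nw; apply: H.
move=> tau_nconst H; apply/eqP/negP => /negP aN0.
have [t0 [taut0 t0tau]] := not_ae_constant tau_nconst.
have t0_gt0 : 0 < t0.
  rewrite ltNge; apply/negP => t00; apply: taut0.
  rewrite (_ : mkset _ = set0) ?measure0//; apply/seteqP; split=> // w /=.
  by move=> /le_trans/(_ t00); rewrite leNgt tau_gt0.
(* An enumeration of the rationals. Codes of no rational yield [0], which the guard [t0 < q n]
   excludes because [t0 > 0]. *)
pose q n : R := ratr (odflt 0 (unpickle n)).
have {}H n : exists B : set R, measurable B /\ (t0 < q n ->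
    {ae P, forall w, tau w <= q n <-> B (zeta w (q n))}).
  have [qn|qn] := leP (q n) t0; first by exists set0; split=> //; rewrite ltNge qn.
  have /completed_sigmaP[B mB HB] := H _ (lt_trans t0_gt0 qn).
  by exists B.
have {H} [B /all_and2[mB HB]] := choice H.
have afterB n : t0 < q n -> {ae distribution P V, forall v, B n v.2}.
  move=> t0q.
  have /(levy_bridge_after zeta_bridge _ (measurableC (mB n))) :
      P [set w | tau w <= q n /\ (~` B n) (zeta w (q n))] = 0%E.
    apply/negligibleP.
      apply: measurableI; first exact: mtau.
      exact: (mzeta _ _ (measurableC (mB n))).
    by apply: negligibleS (HB n t0q) => w [/= tauw nB] [+ _] => /(_ tauw).
  move=> [K [mK K0 HK]]; apply: pair_ae_snd => //.
  have PtauZ : P [set w | tau w <= q n /\ (~` B n) (Z w)] = 0%E.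
    apply: (@subset_measure0 _ _ _ P _ (V @^-1` K) _ _ _ K0).
    - by apply: measurableI; [exact: mtau|exact/mZ/measurableC].
    - by rewrite -[X in measurable X]setTI; exact: measurable_funPT.
    - by move=> w [tauw nB]; apply: HK => /= /(_ tauw).
  have mq : measurable [set s : R | s <= q n].
    by rewrite -set_itvNyc; exact: measurable_itv.
  (* By independence [P(tau <= q n) * P(Z \notin B n) = 0], and the first factor is at least
     [P(tau <= t0) > 0]. *)
  have := esym (tau_Z_indep _ _ mq (measurableC (mB n))).
  move=> /(fun H => etrans H PtauZ)/eqP; rewrite mule_eq0 => /orP[/eqP tauq|/eqP//].
  exfalso; apply: taut0.
  apply: (@subset_measure0 _ _ _ P _ _ (mtau t0) (mtau (q n)) _ tauq).
  by move=> w /= /le_trans; apply; exact: ltW.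
pose avoids n (v : R * R) :=
  (\int[distribution PX (path_at (q n))]_(x in B n)
     f (v.1 - q n)%R (v.2 - x)%R = 0)%E.
have beforeB n : t0 < q n -> {ae distribution P V, forall v : R * R, q n < v.1 ->
    avoids n v}.
  move=> t0q.
  apply/(levy_bridge_before X_density zeta_bridge _ (mB n)).
    by rewrite ltW// (lt_trans t0_gt0).
  apply/negligibleP; first by apply: measurableI; [exact: mtauC|exact: mzeta].
  apply: negligibleS (HB n t0q) => w [/= tauw nB] [_ /(_ nB)].
  by rewrite leNgt tauw.
pose good (v : R * R) := (0 < f v.1 v.2)%E /\ forall n, t0 < q n ->
  B n v.2 /\ (q n < v.1 -> avoids n v).
have [M [mM M0 goodM]] : {ae distribution P V, forall v, good v}.
  have [fpos _] := zeta_bridge.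
  have Hn n : {ae distribution P V, forall v : R * R, t0 < q n ->
      B n v.2 /\ (q n < v.1 -> avoids n v)}.
    have [t0q|t0q] := ltP t0 (q n); last exact: aeW.
    by apply: filterS2 (afterB n t0q) (beforeB n t0q) => v; split.
  by apply: filterS2 fpos (ae_foralln Hn) => v [fv _] Hv; split.
(* [M] is null for the product of the laws of [tau] and [Z], so almost every section is null, while
   [tau > t0] has positive probability. *)
have [r t0r Mr] : exists2 r, t0 < r & distribution P Z (xsection M r) = 0%E.
  apply: contrapT => nr; apply: t0tau.
  move: M0; rewrite independent_RV_product// /product_measure1 => M0.
  have : {ae distribution P tau, forall r,
      (setT : set R) r -> distribution P Z (xsection M r) = 0%E}.
    apply/(@ae_eq_integral_abs _ _ _ (distribution P tau) setT measurableT).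
      exact: measurable_fun_xsection.
    by rewrite -[RHS]M0; apply: eq_integral => x _; rewrite gee0_abs.
  move=> [K [mK K0 HK]].
  have mK' : measurable (tau @^-1` K).
    by rewrite -[X in measurable X]setTI; exact: measurable_funPT.
  apply: (@subset_measure0 _ _ _ P _ _ (mtauC t0) mK' _ K0).
  move=> w /= t0w; apply: HK => /= /(_ I) Hw; apply: nr; by exists (tau w).
pose A := ~` xsection M r.
have mA : measurable A by apply: measurableC; exact: measurable_xsection.
have goodA z : A z -> good (r, z).
  move=> Az; apply: contrapT => /goodM Mrz; apply: Az.
  by rewrite /xsection/= inE.
have r0 : 0 < r by exact: lt_trans t0r.
(* The complement of [A] is null for [Z], hence for [PZac] because [a_ac] is nonzero. A
   Lebesgue-null [A] would be null for [PZac] as well. *)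
have lebA : lebesgue_measure A <> 0%E.
  move=> lebA.
  have PZacA : PZac A = 0%E by move/null_content_dominatesP : PZac_leb; exact.
  have PZacAC : PZac (~` A) = 0%E.
    have PZAC : distribution P Z (~` A) = 0%E by rewrite /A setCK.
    have /eqP := etrans (esym (PZE _ (measurableC mA))) PZAC.
    rewrite padde_eq0; last 2 first.
    - by rewrite mule_ge0// lee_fin subr_ge0.
    - by rewrite mule_ge0// lee_fin.
    by rewrite !mule_eq0 !eqe (negbTE aN0) => /andP[_ /eqP].
  have := probability_setT PZac; rewrite -(setvU A) => PZac1.
  have := etrans (esym (measureU0 (measurableC mA) mA PZacA)) PZac1.
  move=> /(etrans (esym PZacAC)).
  by move=> /eqP; rewrite eqe eq_sym oner_eq0.
(* The density [f r] is positive on [A], which is not Lebesgue-null. *)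
have muA : (0 < distribution PX (path_at r) A)%E.
  rewrite lt0e measure_ge0 andbT; apply/eqP => muA0; apply: lebA.
  have [mf f0 fE] := X_density _ r0.
  have intf0 : (\int[lebesgue_measure]_(x in A) f r x = 0)%E.
    by rewrite -(fE _ mA); exact: muA0.
  have intf : (\int[lebesgue_measure]_(x in A) `|f r x| = 0)%E.
    by rewrite -[RHS]intf0; apply: eq_integral => x _; rewrite gee0_abs.
  have mfA : measurable_fun A (f r) by exact: measurable_funTS.
  have := (@ae_eq_integral_abs _ _ R lebesgue_measure A mA (f r) mfA).1 intf.
  move=> fae; apply/negligibleP => //.
  apply: negligibleS fae => x Ax /= /(_ Ax) fx0.
  by have [+ _] := goodA x Ax; rewrite /= fx0 ltxx.
have [del del0 Hdel] := levy_two_times_pos X_levy X_density t0_gt0 mA muA.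
have [x t0x xr] : exists2 x : rat, t0 < ratr x & r - del < ratr x < r.
  have /rat_in_itvoo[x] : Num.max t0 (r - del) < r.
    by rewrite gt_max t0r/= ltrBlDr ltrDl.
  by rewrite in_itv/= gt_max => /andP[/andP[? ?] ?]; exists x => //; apply/andP.
have [n qn] : exists n, q n = ratr x by exists (pickle x); rewrite /q pickleK.
move: t0x xr; rewrite -qn => t0q /andP[rq qr].
apply: (Hdel _ (ltW t0q) rq qr).
have q0 : 0 <= q n by rewrite ltW// (lt_trans t0_gt0).
have rq0 : 0 < r - q n by rewrite subr_gt0.
have qrE : q n + (r - q n) = r by rewrite addrC subrK.
have := levy_two_times_null X_levy X_density q0 rq0 mA mA; rewrite qrE; apply.
move=> z /goodA[_ /(_ n t0q)[_ /(_ qr) Bz]].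
have [mf f0 _] := X_density _ rq0.
apply/eqP; rewrite eq_le integral_ge0 ?andbT//.
(* [A] lies in [B n], over which the integral vanishes by [avoids]. *)
rewrite -[leRHS]Bz; apply: ge0_subset_integral => //.
- by apply: measurable_funTS; apply: (measurableT_comp mf); exact: measurable_funB.
- by move=> y /goodA[_ /(_ n t0q)[]].
Qed.
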